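(* Let $n\geq 2$ and let $G=\mathbb{T}^n$ be the $n$-torus. Then $G$ does not admit any automorphism that acts expansively on $\mathrm{Sub}^p_G$.
   Context: $\mathbb{T}^n=\mathbb{R}^n/\mathbb{Z}^n$. Automorphisms of topological groups are group automorphisms that are also homeomorphisms. For a locally compact Hausdorff group $G$, $\mathrm{Sub}_G$ denotes the set of all closed subgroups of $G$ with the Chabauty topology, generated by the sub-basis consisting of the sets $\{H\in\mathrm{Sub}_G\mid H\cap K=\emptyset\}$, $K\subset G$ compact, and $\{H\in\mathrm{Sub}_G\mid H\cap U\neq\emptyset\}$, $U\subset G$ open. This space is compact and Hausdorff, and metrizable if $G$ is second countable. A one-parameter subgroup of $G$ is (the image of) a continuous homomorphism $\mathbb{R}\to G$ (the trivial one is allowed). $\mathrm{Sub}^p_G$ denotes the smallest closed subset of $\mathrm{Sub}_G$ containing all closed one-parameter subgroups of $G$. An automorphism $T$ of $G$ acts on $\mathrm{Sub}_G$ by the homeomorphism $H\mapsto T(H)$, which leaves $\mathrm{Sub}^p_G$ invariant. A homeomorphism $\phi$ of a metrizable space $X$ with metric $d$ is expansive if there exists $\epsilon>0$ such that for all $x\neq y$ in $X$, $\sup\{d(\phi^n(x),\phi^n(y))\mid n\in\mathbb{Z}\}>\epsilon$; for compact $X$ this does not depend on the choice of the compatible metric $d$. $T$ acts expansively on $\mathrm{Sub}^p_G$ if the induced homeomorphism $H\mapsto T(H)$ of $\mathrm{Sub}^p_G$ is expansive. *)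

(* Defs.v *)
From HB Require Import structures.
From mathcomp Require Import all_boot all_order all_algebra finmap.
From mathcomp Require Import all_classical all_reals all_analysis.

Set Implicit Arguments.
Unset Strict Implicit.
Unset Printing Implicit Defensive.

Import Order.TTheory GRing.Theory Num.Theory.
Import numFieldNormedType.Exports.

Local Open Scope classical_set_scope.
Local Open Scope ring_scope.

Record homeomorphism (X : topologicalType) := Homeomorphism {
  homeo_fun :> X -> X ;
  homeo_inv : X -> X ;
  homeo_funK : cancel homeo_fun homeo_inv ;
  homeo_invK : cancel homeo_inv homeo_fun ;
  homeo_continuous : continuous homeo_fun ;
  homeo_inv_continuous : continuous homeo_inv }.

(* [phi ^ k] for [k : int]; recall that [Negz n] denotes [- n.+1]. *)
Definition homeo_iter (X : topologicalType) (phi : homeomorphism X) (k : int) :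
    X -> X :=
  match k with
  | Posz n => iter n phi
  | Negz n => iter n.+1 (homeo_inv phi)
  end.

Record compatible_metric (R : realType) (X : topologicalType)
    (d : X -> X -> R) : Prop := CompatibleMetric {
  cmetric_ge0 : forall x y, 0 <= d x y ;
  cmetric_eq0 : forall x y, d x y = 0 <-> x = y ;
  cmetric_sym : forall x y, d x y = d y x ;
  cmetric_triangle : forall x y z, d x z <= d x y + d y z ;
  cmetric_nbhs : forall x,
    nbhs x = nbhs_ball_ (fun y e => [set z | d y z < e]) x }.

(* Expansiveness asks for some metric inducing the topology; on a compact
   metrizable space the choice of the metric is irrelevant.
   The supremum is taken in [\bar R], so that it is meaningful for unbounded
   [d] as well. *)
Definition expansive (R : realType) (X : topologicalType)
    (phi : homeomorphism X) : Prop :=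
  exists2 d : X -> X -> R, compatible_metric d &
    exists2 e : R, 0 < e & forall x y : X, x <> y ->
      (e%:E < ereal_sup [set (d (homeo_iter phi k x) (homeo_iter phi k y))%:E
                        | k in [set: int]])%E.

(* Topological groups are written additively: only abelian ones are needed. *)
Record automorphism (G : topologicalZmodType) := Automorphism {
  aut_homeo :> homeomorphism G ;
  aut_add : {morph aut_homeo : x y / x + y} }.

Record closed_subgroup (G : topologicalZmodType) := ClosedSubgroup {
  subgroup_set :> set G ;
  subgroup_closed : closed subgroup_set ;
  subgroup0 : subgroup_set 0 ;
  subgroupB : forall x y,
    subgroup_set x -> subgroup_set y -> subgroup_set (x - y) }.

HB.instance Definition _ G := gen_eqMixin (closed_subgroup G).
HB.instance Definition _ G := gen_choiceMixin (closed_subgroup G).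

Definition chabauty_subbase (G : topologicalZmodType) :
    set (set (closed_subgroup G)) :=
  [set [set H : closed_subgroup G | H `&` K = set0] | K in compact] `|`
  [set [set H : closed_subgroup G | H `&` U !=set0] | U in open].

HB.instance Definition _ (G : topologicalZmodType) :=
  isSubBaseTopological.Build (closed_subgroup G) (@chabauty_subbase G) id.

Lemma closed_subgroup_inj (G : topologicalZmodType) :
  injective (@subgroup_set G).
Proof.
move=> [A cA A0 AB] [B cB B0 BB] /= eAB; subst B.
by congr ClosedSubgroup; exact: Prop_irrelevance.
Qed.

Definition one_parameter_subgroup (R : realType) (G : topologicalZmodType)
    (A : set G) : Prop :=
  exists2 f : {additive R -> G}, continuous f & range f = A.

(* Sub^p_G: closure of the closed one-parameter subgroups in the Chabauty
   topology. *)
Definition Subp (R : realType) (G : topologicalZmodType) :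
    set (closed_subgroup G) :=
  smallest closed [set H : closed_subgroup G | one_parameter_subgroup R H].

Section action.
Variables (G : topologicalZmodType).
Implicit Types (T : automorphism G) (H : closed_subgroup G).

Definition homeo_symm (X : topologicalType) (phi : homeomorphism X) : homeomorphism X :=
  Homeomorphism (homeo_invK phi) (homeo_funK phi)
    (@homeo_inv_continuous _ phi) (@homeo_continuous _ phi).

Lemma homeo_image (X : topologicalType) (phi : homeomorphism X) (A : set X) :
  phi @` A = homeo_inv phi @^-1` A.
Proof.
apply/seteqP; split=> [_ [x Ax <-]|x Ax]; first by rewrite /= homeo_funK.
by exists (homeo_inv phi x) => //; rewrite homeo_invK.
Qed.

Lemma aut_inv_add T : {morph homeo_inv T : x y / x + y}.
Proof.
by move=> x y; apply: (can_inj (homeo_funK T)); rewrite aut_add !homeo_invK.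
Qed.

Definition aut_symm T : automorphism G :=
  @Automorphism G (homeo_symm T) (@aut_inv_add T).

Lemma aut0 T : T 0 = 0.
Proof. by apply: (@addrI _ (T 0)); rewrite -aut_add !addr0. Qed.

Lemma autB T x y : T (x - y) = T x - T y.
Proof. by apply: (@addIr _ (T y)); rewrite -aut_add !subrK. Qed.

Lemma aut_image_closed T H : closed (T @` H).
Proof.
rewrite homeo_image; move: (homeo_inv_continuous (h := T)).
by move=> /continuous_closedP; apply; exact: subgroup_closed.
Qed.

Lemma aut_image0 T H : (T @` H) 0.
Proof. by exists 0; [exact: subgroup0|exact: aut0]. Qed.

Lemma aut_imageB T H x y :
  (T @` H) x -> (T @` H) y -> (T @` H) (x - y).
Proof.
move=> [u Hu <-] [v Hv <-]; exists (u - v); first exact: subgroupB.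
exact: autB.
Qed.

Definition aut_image T H : closed_subgroup G :=
  ClosedSubgroup (@aut_image_closed T H) (@aut_image0 T H) (@aut_imageB T H).

Lemma aut_imageK T : cancel (aut_image T) (aut_image (aut_symm T)).
Proof.
move=> H; apply: closed_subgroup_inj => /=.
rewrite image_comp -[RHS]image_id; apply: eq_imagel => x _ /=.
by rewrite homeo_funK.
Qed.

Lemma aut_imageVK T : cancel (aut_image (aut_symm T)) (aut_image T).
Proof.
move=> H; apply: closed_subgroup_inj => /=.
rewrite image_comp -[RHS]image_id; apply: eq_imagel => x _ /=.
by rewrite homeo_invK.
Qed.

Lemma chabauty_continuous (X : topologicalType) (f : X -> closed_subgroup G) :
  (forall B, chabauty_subbase B -> open (f @^-1` B)) -> continuous f.
Proof.
move=> fB; apply/continuousP => _ [D' sD <-].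
rewrite preimage_bigcup; apply: bigcup_open => A /sD [F sF <-].
rewrite preimage_bigcap bigcap_fset /=.
by rewrite big_seq; apply: big_ind => [||B /sF]; [exact: openT|exact: openI|];
  rewrite inE; exact: fB.
Qed.

Lemma sub_open_subbase (B : set (closed_subgroup G)) :
  chabauty_subbase B -> open B.
Proof.
move=> hB; exists [set B]; last by rewrite bigcup_set1.
move=> _ ->; exists [fset B]%fset; first by move=> C; rewrite in_fset1 => /eqP ->; rewrite inE.
apply/seteqP; split=> [H|H BH C] /=.
  by apply; rewrite /= in_fset1.
by rewrite in_fset1 => /eqP ->.
Qed.

Lemma image_homeo_eq0 T (A B : set G) :
  ((T @` A) `&` B = set0) = (A `&` homeo_inv T @` B = set0).
Proof.
rewrite (homeo_image T) (homeo_image (homeo_symm T)) /=; apply/propext.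
rewrite -!subset0; split=> h x [/= Ax Bx].
  by apply: (h (T x)); split=> //=; rewrite homeo_funK.
by apply: (h (homeo_inv T x)); split=> //=; rewrite homeo_invK.
Qed.

Lemma aut_image_continuous T : continuous (aut_image T).
Proof.
apply: chabauty_continuous => _ [] [A hA <-].
- apply: sub_open_subbase; left; exists (homeo_inv T @` A).
    apply: continuous_compact hA; apply: continuous_subspaceT.
    exact: homeo_inv_continuous.
  by apply/seteqP; split=> H /=; rewrite image_homeo_eq0.
- apply: sub_open_subbase; right; exists (homeo_inv T @` A).
    rewrite (homeo_image (homeo_symm T)).
    by move: (homeo_continuous (h := T)) => /continuousP; apply.
  apply/seteqP; split=> H /=; rewrite -!set0P; apply: contra_neq;
    by rewrite image_homeo_eq0.
Qed.

Lemma one_parameter_image (R : realType) T (A : set G) :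
  one_parameter_subgroup R A -> one_parameter_subgroup R (T @` A).
Proof.
move=> [f cf <-].
have gadd : {morph (T \o f) : x y / x + y}.
  by move=> x y; rewrite /= raddfD aut_add.
have g0 : (T \o f) 0 = 0 by rewrite /= raddf0 aut0.
pose m := GRing.isNmodMorphism.Build _ _ (T \o f) (conj g0 gadd).
pose g : {additive R -> G} := HB.pack (T \o f) m.
exists g.
  move=> x; apply: continuous_comp; first exact: cf.
  exact: homeo_continuous.
by rewrite /g /= image_comp.
Qed.

Lemma Subp_aut_image (R : realType) T H :
  @Subp R G H -> @Subp R G (aut_image T H).
Proof.
move: H; apply: smallest_sub => [|H H1]; last first.
  by apply: sub_gen_smallest; exact: one_parameter_image.
have /continuous_closedP := @aut_image_continuous T.
by apply; rewrite /Subp -closureE; exact: closed_closure.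
Qed.

(* As a type, [Subp R G] is the [set_type] with the subspace topology. *)
Definition Subp_map (R : realType) T (H : @Subp R G) : @Subp R G :=
  SigSub (mem_set (Subp_aut_image T (set_mem (valP H)))).

Lemma Subp_mapK (R : realType) T :
  cancel (@Subp_map R T) (@Subp_map R (aut_symm T)).
Proof. by move=> H; apply: val_inj; exact: aut_imageK. Qed.

Lemma Subp_mapVK (R : realType) T :
  cancel (@Subp_map R (aut_symm T)) (@Subp_map R T).
Proof. by move=> H; apply: val_inj; exact: aut_imageVK. Qed.

Lemma Subp_map_continuous (R : realType) T : continuous (@Subp_map R T).
Proof.
apply: continuous_comp_initial => H /=.
apply: (@continuous_comp _ _ _ set_val (aut_image T)).
  exact: initial_continuous.
exact: aut_image_continuous.
Qed.

Definition Subp_homeo (R : realType) T : homeomorphism (@Subp R G) :=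
  Homeomorphism (@Subp_mapK R T) (@Subp_mapVK R T)
    (@Subp_map_continuous R T) (@Subp_map_continuous R (aut_symm T)).

End action.

Definition acts_expansively_on_Subp (R : realType) (G : topologicalZmodType)
    (T : automorphism G) : Prop :=
  expansive R (Subp_homeo R T).

Section torus.
Local Open Scope quotient_scope.
Variables (R : realType) (n : nat).

Definition integer_vector : {pred 'rV[R]_n} :=
  fun v => v \is a mxOver Num.int.

Lemma integer_vector_zmod_closed : zmod_closed integer_vector.
Proof.
split=> [|u v /mxOverP hu /mxOverP hv]; apply/mxOverP => i j; rewrite !mxE.
  exact: rpred0.
by rewrite rpredB.
Qed.

HB.instance Definition _ :=
  GRing.isZmodClosed.Build 'rV[R]_n integer_vector integer_vector_zmod_closed.

Definition torus : Type := quotient_topology (Quotient.quot integer_vector).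

HB.instance Definition _ := Topological.copy torus
  (quotient_topology (Quotient.quot integer_vector)).

HB.instance Definition _ := GRing.isZmodule.Build torus
  (@Quotient.addqA _ integer_vector) (@Quotient.addqC _ integer_vector)
  (@Quotient.add0q _ integer_vector) (@Quotient.addNq _ integer_vector).

Definition torus_proj (x : 'rV[R]_n) : torus := \pi_(Quotient.quot integer_vector) x.

Lemma torus_projB : {morph torus_proj : x y / x - y}.
Proof.
move=> x y; rewrite /torus_proj (Quotient.pi_add integer_vector x (- y)).
by rewrite Quotient.pi_opp.
Qed.

Lemma torus_projP x y : torus_proj x = torus_proj y <-> integer_vector (x - y).
Proof.
rewrite -[integer_vector _]/((x - y) \in integer_vector).
by rewrite Quotient.idealrBE; split=> [h|/eqP //]; apply/eqP.
Qed.

Lemma torus_projK (q : torus) : exists x, torus_proj x = q.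
Proof. by exists (repr q); exact: reprK. Qed.

Lemma torus_proj_continuous : continuous torus_proj.
Proof. exact: pi_continuous. Qed.

Lemma torus_proj_open (A : set 'rV[R]_n) : open A -> open (torus_proj @` A).
Proof.
move=> oA; rewrite -[open _]/(open (torus_proj @^-1` (torus_proj @` A))).
rewrite (_ : _ @^-1` _ =
    \bigcup_(z in integer_vector) ((fun x => x + z) @^-1` A)).
  apply: bigcup_open => z _.
  have /continuousP : continuous (fun x : 'rV[R]_n => x + z); last exact.
  move=> x; have h : y + z @[y --> nbhs x] --> nbhs (x + z); last exact: h.
  by apply: cvgD; [exact: cvg_id|exact: cvg_cst].
apply/seteqP; split=> [x [y Ay /torus_projP yx]|x [z hz Az]].
  by exists (y - x) => //=; rewrite addrC subrK.
by exists (x + z) => //; apply/torus_projP; rewrite addrAC subrr add0r.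
Qed.

Lemma torus_sub_continuous : continuous (fun x : torus * torus => x.1 - x.2).
Proof.
move=> [p q]; have [x <-] := torus_projK p; have [y <-] := torus_projK q.
move=> W /=; rewrite -torus_projB => /torus_proj_continuous hW.
have [[A B] /= [hA hB] hAB] := sub_continuous (x := (x, y)) hW.
have proj_nbhs u (C : set 'rV[R]_n) :
    nbhs u C -> nbhs (torus_proj u) (torus_proj @` C).
  rewrite nbhsE => -[D [oD Du] DC]; apply: (filterS (image_subset torus_proj DC)).
  by apply: open_nbhs_nbhs; split; [exact: torus_proj_open|exists u].
exists (torus_proj @` A, torus_proj @` B) => /=.
  by split; exact: proj_nbhs.
move=> [_ _] /= [[u Au <-] [v Bv <-]] /=; rewrite -torus_projB.
exact: (hAB (u, v)).
Qed.

HB.instance Definition _ :=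
  PreTopologicalNmodule_isTopologicalZmodule.Build torus torus_sub_continuous.

End torus.

(* Main.v *)
Require Import Defs.
From HB Require Import structures.
From mathcomp Require Import all_boot all_order all_algebra.
From mathcomp Require Import all_fingroup.
From mathcomp Require Import all_classical all_reals all_analysis.
From mathcomp Require Import zify ring lra.

(** An integer vector [v] defines the character [x |-> x.v] of the torus and the
   closed subgroup [H_v] that is its kernel; [H_0] is the whole torus.  Each
   automorphism [T] of the torus is given by an invertible integer matrix
   ([torus_aut_unit_matrix]), because a continuous homomorphism from the reals
   to the torus lifts to a line ([one_parameter_is_line]).  Hence [T] permutes
   the subgroups [H_v] through the linear action of an invertible integer
   matrix [P] on [v], and it fixes [H_0].

   The whole torus is the limit of the [H_w] when [w] goes to infinity
   ([character_kernel_at_infinity]): the hyperplanes [x.w] in [Z] become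
   dense.  So the orbits of [H_v] and [H_0] stay within a given distance as
   soon as all the vectors [P ^ k v], for [k] in [Z], lie outside a certain
   finite box.  If for every box some such [v] exists with [H_v] in [Sub^p],
   then [T] is not expansive.

   Membership in [Sub^p] holds when some integer row [c] satisfies [c.v = 1]:
   then [H_v] is a subtorus, the image of a rational subspace, and a rational
   subtorus is a limit of circles ([rational_subtorus_Subp]).

   It remains to find such a [v] whose orbit avoids the box.  If there were
   none, each vector [(a, a t + 1, 0, ..., 0)] would be in the orbit of one of
   the finitely many vectors of the box.  Count modulo [m = 2 ^ K.+1].  Since [P]
   has order at most [C 2 ^ K] modulo [m] ([unit_mx_order_mod_pow2]), these orbits
   contain at most [C D 2 ^ K] residues, with [D] the number of points in the
   box.  But the vectors with [a] odd give [2 ^ K * m] distinct residues, which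
   is more when [K] is large ([escaping_planar_vector]).  This is where the
   dimension is at least 2: the number of residues grows quadratically in [m],
   the order of [P] only linearly. *)

Set Implicit Arguments.
Unset Strict Implicit.
Unset Printing Implicit Defensive.

Import Order.TTheory GRing.Theory Num.Theory.
Import numFieldNormedType.Exports.

Local Open Scope classical_set_scope.
Local Open Scope ring_scope.

(** * Orbits of integer vectors under an invertible integer matrix *)

(** The group of invertible matrices modulo 2 is finite. *)
Lemma unit_mx_order_mod2 n (P : 'M[int]_n.+1) : P \is a GRing.unit ->
  exists2 C, (0 < C)%N & exists X, P ^+ C = 1 + X *+ 2.
Proof.
move=> uP; have urP : map_mx (intr : int -> 'F_2) P \is a GRing.unit.
  exact: rmorph_unit.
pose u : {unit 'M['F_2]_n.+1} := FinRing.unit _ urP.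
exists #[u]%g; first exact: order_gt0.
have rP1 : map_mx (intr : int -> 'F_2) (P ^+ #[u]%g) = 1.
  rewrite rmorphXn /= -[map_mx _ P]/(val u) -FinRing.val_unitX expg_order.
  exact: FinRing.val_unit1.
exists (\matrix_(i, j) ((P ^+ #[u]%g - 1) i j %/ 2)%Z).
apply/matrixP => i j; rewrite [RHS]mxE mulmxnE [X in _ + X *+ _]mxE.
have /divzK : (2 %| (P ^+ #[u]%g - 1) i j)%Z.
  rewrite (dvdz_pcharf (pchar_Fp (isT : prime 2))).
  have : map_mx (intr : int -> 'F_2) (P ^+ #[u]%g - 1) i j = 0.
    by rewrite rmorphB /= rP1 rmorph1 subrr mxE.
  by rewrite mxE => ->.
have -> : (P ^+ #[u]%g) i j = (P ^+ #[u]%g - 1) i j + (1 : 'M[int]_n.+1) i j.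
  by rewrite !mxE subrK.
by move=> {1}<-; rewrite addrC mulr_natr.
Qed.

(** For [j] positive, the square of [1 + 2 ^ j z] is [1 + 2 ^ j.+1 z'] for some
   [z'], so every squaring gains a factor 2. *)
Lemma exprn_two_adic (A : nzRingType) (x y : A) (K : nat) : x = 1 + y *+ 2 ->
  exists z, x ^+ (2 ^ K) = 1 + z *+ (2 ^ K.+1).
Proof.
move=> ->; elim: K => [|K [z IH]]; first by exists y; rewrite expr1.
exists (z + z ^+ 2 *+ (2 ^ K)).
rewrite [in LHS]expnSr exprM IH addrC sqrrD1 exprMn_n mulrnDl -!mulrnA.
rewrite addrC [X in _ + X]addrC; congr (1 + (z *+ _ + _ *+ _)).
  by rewrite -expnSr.
by rewrite -expnM -expnD; congr (2 ^ _)%N; lia.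
Qed.

(** The point is that [C] does not depend on [K]: the order modulo [2 ^ K.+1]
   grows at most linearly in the modulus. *)
Lemma unit_mx_order_mod_pow2 n (P : 'M[int]_n.+1) : P \is a GRing.unit ->
  exists2 C, (0 < C)%N & forall K,
    map_mx (intr : int -> 'Z_(2 ^ K.+1)) (P ^+ (C * 2 ^ K)) = 1.
Proof.
move=> uP; have [C C0 [X PC]] := unit_mx_order_mod2 uP.
exists C => // K; rewrite exprM; have [Y ->] := exprn_two_adic K PC.
rewrite rmorphD rmorph1 rmorphMn /=.
apply/matrixP => i j; rewrite mxE mulmxnE -mulr_natr.
by rewrite pchar_Zp ?mulr0 ?addr0 // (ltn_exp2l 0 K.+1).
Qed.

(** The choice of [a * t + 1] makes the coordinates coprime for all [a] and
   [t]. *)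
Definition planar_vector n (a t : int) : 'cV[int]_n.+2 :=
  \col_i (if i == 0 then a else if i == 1 then a * t + 1 else 0).

(** An odd [a] is invertible modulo a power of 2, so [a * t + 1] determines
   [t]. *)
Lemma planar_vector_mod_inj n K (i i' : 'I_(2 ^ K)) (t t' : 'I_(2 ^ K.+1)) :
  map_mx (intr : int -> 'Z_(2 ^ K.+1)) (planar_vector n (i.*2.+1)%:Z t%:Z) =
  map_mx intr (planar_vector n (i'.*2.+1)%:Z t'%:Z) -> (i, t) = (i', t').
Proof.
have m1 : (1 < 2 ^ K.+1)%N by rewrite (ltn_exp2l 0 K.+1).
have natr_inj a b : (a < 2 ^ K.+1)%N -> (b < 2 ^ K.+1)%N ->
    a%:R = b%:R :> 'Z_(2 ^ K.+1) -> a = b.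
  move=> ha hb /(congr1 val) /=; rewrite !val_Zp_nat //.
  by rewrite !modn_small.
have odd_lt (j : 'I_(2 ^ K)) : (j.*2.+1 < 2 ^ K.+1)%N.
  by rewrite expnS; have := ltn_ord j; lia.
move=> /matrixP e.
have ei : i = i'.
  have := e ord0 0; rewrite !mxE /= => /natr_inj => /(_ (odd_lt i) (odd_lt i')).
  by move=> ii; apply: val_inj => /=; lia.
subst i'; congr (_, _).
have := e (lift ord0 ord0) 0; rewrite !mxE /= !rmorphD !rmorphM /=.
move=> /addIr; have u : (i.*2.+1)%:R \is a @GRing.unit 'Z_(2 ^ K.+1).
  by rewrite unitZpE // coprimeXl // coprime2n /= odd_double.
move=> /(mulrI u) /natr_inj tt'.
by apply: val_inj; apply: tt'.
Qed.

(** Otherwise each [v] of the family is [P ^ (- k) w] with [w] in the box, and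
   its residue is determined by [w] and by [- k] modulo the order [N] of [P]:
   there are too few such pairs. *)
Lemma escaping_planar_vector n (P : 'M[int]_n.+2) (B : nat) :
  P \is a GRing.unit -> exists a t : int, forall k : int,
  exists i, (B < `|(P ^ k *m planar_vector n a t) i 0%R|)%N.
Proof.
move=> uP; have [C C0 PC] := unit_mx_order_mod_pow2 uP.
pose D := #|{ffun 'I_n.+2 -> 'I_(B.*2.+1)}|.
pose K := (C * D)%N; pose N := (C * 2 ^ K)%N.
have N0 : (0 < N)%N by rewrite muln_gt0 C0 expn_gt0.
apply: contrapT => no_escape.
pose vec (x : 'I_(2 ^ K) * 'I_(2 ^ K.+1)) :=
  planar_vector n (x.1.*2.+1)%:Z x.2%:Z.
have /choice [k kB] x : exists k : int, forall i, (`|(P ^ k *m vec x) i 0%R| <= B)%N.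
  apply: contrapT => kx; apply: no_escape.
  exists (x.1.*2.+1)%:Z, x.2%:Z => k; apply: contrapT => ki; apply: kx.
  by exists k => i; rewrite leqNgt; apply/negP => Bi; apply: ki; exists i.
(* The coordinates of a point of the box lie between [- B] and [B]. *)
pose shifted x : {ffun 'I_n.+2 -> 'I_(B.*2.+1)} :=
  [ffun i => inord `|((P ^ k x *m vec x) i 0 + B%:Z)%R|%N].
pose code x := (Ordinal (ltn_pmod `|(- k x %% N%:Z)%Z|%N N0), shifted x).
have code_inj : injective code.
  move=> x y [kxy /ffunP sxy].
  have Pxy : P ^ k x *m vec x = P ^ k y *m vec y.
    apply/matrixP => i j; rewrite (ord1 j).
    have := sxy i; rewrite !ffunE => /(congr1 val) /=.
    have := kB x i; have := kB y i.
    set u := (_ *m _) i 0; set v := (_ *m _) i 0 => hu hv.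
    by rewrite !inordK; lia.
  suff rPxy : map_mx (intr : int -> 'Z_(2 ^ K.+1)) (P ^ (- k x)) =
              map_mx (intr : int -> 'Z_(2 ^ K.+1)) (P ^ (- k y)).
    case: x y {kxy sxy} Pxy rPxy => [i t] [i' t'] Pxy rPxy.
    apply: (@planar_vector_mod_inj n); rewrite -/(vec (i, t)) -/(vec (i', t')).
    have cancel z : vec z = P ^ (- k z) *m (P ^ k z *m vec z).
      by rewrite mulmxA -[_ *m P ^ _]exprzDr // addNr expr0z mul1mx.
    by rewrite (cancel (i, t)) (cancel (i', t')) Pxy !map_mxM rPxy.
  have reduce z : map_mx (intr : int -> 'Z_(2 ^ K.+1)) (P ^ z) =
      map_mx intr (P ^+ (`|(z %% N%:Z)%Z| %% N)).
    have zN : (z %% N%:Z)%Z = `|(z %% N%:Z)%Z|%N by lia.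
    rewrite modn_small; last by lia.
    rewrite {1}(divz_eq z N) exprzDr // mulrC -exprz_exp {1}zN.
    by rewrite rmorphM rmorphXz /= ?unitrX // PC exp1rz mul1r.
  by rewrite !reduce kxy.
have /= := leq_card code code_inj.
rewrite !card_prod !card_ord -/D /N mulnAC -/K mulnC leq_mul2r.
rewrite expn_eq0 /= leqNgt => /negP; apply.
by rewrite (ltn_trans (ltn_expl K (isT : 1 < 2)%N)) ?ltn_exp2l.
Qed.

(** * Convergence in the Chabauty topology and topology of the torus *)

(** Disjointness from a compact set is inherited by subgroups, so convergence
   from inside [H] only involves the open sets of the sub-basis. *)
Lemma chabauty_cvg_from_below (G : topologicalZmodType) (I : Type)
    (F : set_system I) {FF : Filter F} (h : I -> closed_subgroup G)
    (H : closed_subgroup G) :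
  (forall i, h i `<=` H) ->
  (forall U, open U -> H `&` U !=set0 ->
    \forall i \near F, h i `&` U !=set0) ->
  h i @[i --> F] --> H.
Proof.
move=> hH hU O; rewrite nbhsE => -[_ [[D sD <-] [A DA AH]] DO].
apply: (@filterS _ F FF (h @^-1` A)).
  by move=> i Ai; apply: DO; exists A.
move: AH; have [J sJ <-] := sD _ DA => JH.
apply: (filter_bigI (f := fun B => h @^-1` B)) => B BJ.
have := JH B BJ; have := sJ _ BJ; rewrite inE => -[[K cK <-]|[U oU <-]] /= HB.
  apply: filterE => i /=; rewrite -subset0 => x [hx Kx]; rewrite -HB; split => //.
  exact: hH hx.
exact: hU.
Qed.

Section torus_topology.
Variable R : realType.

Lemma closed_num_int : closed [set x : R | x \is a Num.int].
Proof.
rewrite -[X in closed X]setCK; apply: open_closedC; rewrite openE => x /= xNint.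
have /andP[xl xr] := floor_itv x.
have {}xl : (Num.floor x)%:~R < x.
  rewrite lt_neqAle xl andbT; apply: contra_notN xNint => /eqP <-.
  exact: intr_int.
apply: (filterS _ (near_in_itvoo (a := (Num.floor x)%:~R)
  (b := (Num.floor x + 1)%:~R) _)); last by rewrite in_itv /= xl.
move=> y; rewrite /= in_itv /= => /andP[yl yr] /intrP[m ym].
by move: yl yr; rewrite ym !ltr_int; lia.
Qed.

Lemma continuous_mx (X : topologicalType) m n (f : X -> 'M[R]_(m, n)) :
  (forall i j, continuous (fun x => f x i j)) -> continuous f.
Proof.
move=> fc x A [P PA sPA].
have : \forall y \near x, forall ij : 'I_m * 'I_n, P ij.1 ij.2 (f y ij.1 ij.2).
  by apply: filter_forall => -[i j]; apply: fc; exact: PA.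
by apply: filterS => y Py; apply: sPA => i j; exact: (Py (i, j)).
Qed.

Lemma mulmxr_continuous m n p (U : 'M[R]_(n, p)) :
  continuous (fun x : 'M[R]_(m, n) => x *m U).
Proof.
apply: continuous_mx => i j.
under eq_fun do rewrite mxE.
apply: continuous_big => [|k _ x].
  by move=> x; exact: add_continuous.
apply: (@continuousM R _ (fun y : 'M[R]_(m, n) => y i k) (fun=> U k j) x).
  exact: coord_continuous.
exact: cst_continuous.
Qed.

Lemma torus_proj0 n : @torus_proj R n 0 = 0.
Proof. by rewrite -{1}(subrr 0) torus_projB subrr. Qed.

Lemma torus_projD n : {morph @torus_proj R n : x y / x + y}.
Proof.
move=> x y; rewrite -{1}[y]opprK torus_projB -[- y]add0r torus_projB torus_proj0.
by rewrite sub0r opprK.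
Qed.

Lemma torus_proj_sum n (I : Type) (r : seq I) (x : I -> 'rV[R]_n) :
  torus_proj (\sum_(i <- r) x i) = \sum_(i <- r) torus_proj (x i).
Proof. exact: (big_morph _ (@torus_projD n) (torus_proj0 n)). Qed.

Lemma torus_proj0_closed n : closed [set 0 : torus R n].
Proof.
have -> : [set 0 : torus R n] = ~` (torus_proj (n := n) @` ~` [set x | integer_vector x]).
  apply/seteqP; split=> [_ -> [x xZ]|p].
    rewrite -torus_proj0 => /torus_projP; rewrite subr0.
    exact: xZ.
  have [x <-] := torus_projK p => xZ.
  rewrite /= -torus_proj0; apply/torus_projP; rewrite subr0.
  by apply: contrapT => nx; apply: xZ; exists x.
apply: open_closedC; apply: torus_proj_open; apply: closed_openC.
rewrite (_ : [set x | _] = \bigcap_(ij in [set: 'I_1 * 'I_n])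
   ((fun x : 'rV[R]_n => x ij.1 ij.2) @^-1` [set y | y \is a Num.int])).
  apply: closed_bigI => ij _.
  have /continuous_closedP := @coord_continuous R 1 n ij.1 ij.2.
  by apply; exact: closed_num_int.
apply/seteqP; split=> [x /mxOverP xZ ij _|x xZ]; first exact: xZ.
by apply/mxOverP => i j; exact: (xZ (i, j)).
Qed.

(** A topological group with closed trivial subgroup is Hausdorff, because
   subtraction is continuous. *)
Lemma torus_hausdorff n : hausdorff_space (torus R n).
Proof.
move=> p q pq; apply: contrapT => /eqP; rewrite -subr_eq0 => /eqP pq0.
have : nbhs (p, q) ((fun x : torus R n * torus R n => x.1 - x.2) @^-1` ~` [set 0]).
  apply: (@torus_sub_continuous R n (p, q)); apply: open_nbhs_nbhs; split => //.
  by apply: closed_openC; exact: torus_proj0_closed.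
move=> [[A B] /= [pA qB] AB].
by have [r [Ar Br]] := pq _ _ pA qB; apply: (AB (r, r)) => //=; rewrite subrr.
Qed.

End torus_topology.

(** * Kernels of characters of the torus *)

Section character_kernels.
Variables (R : realType) (n : nat).
Implicit Types v w : 'cV[int]_n.

Definition character_kernel_set v : set (torus R n) :=
  @torus_proj R n @` [set x | (x *m map_mx intr v) 0 0 \is a Num.int].

Lemma character_kernel_setP v (x : 'rV[R]_n) :
  character_kernel_set v (torus_proj x) <->
  (x *m map_mx intr v) 0 0 \is a Num.int.
Proof.
split=> [[y yv /torus_projP/mxOverP yx]|xv]; last by exists x.
have -> : x = y - (y - x) by rewrite opprB addrC subrK.
rewrite mulmxBl mxE rpredD // mxE rpredN mxE rpred_sum // => i _.
by rewrite rpredM // mxE intr_int.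
Qed.

Lemma character_kernel_closed v : closed (character_kernel_set v).
Proof.
rewrite -[X in closed X]setCK; apply: open_closedC.
rewrite (_ : ~` _ = torus_proj (n := n) @`
    ~` [set x | (x *m map_mx intr v) 0 0 \is a @Num.int R]).
  apply: torus_proj_open; apply: closed_openC.
  have /continuous_closedP c1 := @mulmxr_continuous R 1 n 1 (map_mx intr v).
  have /continuous_closedP c2 := @coord_continuous R 1 1 0 0.
  by have := c1 _ (c2 _ (@closed_num_int R)).
apply/seteqP; split=> [p|_ [x xv <-] /character_kernel_setP //].
have [x <-] := torus_projK p => xv; exists x => // hx.
by apply: xv; apply/character_kernel_setP.
Qed.

Lemma character_kernel0 v : character_kernel_set v 0.
Proof. by rewrite -torus_proj0; apply/character_kernel_setP; rewrite mul0mx mxE. Qed.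

Lemma character_kernelB v p q : character_kernel_set v p ->
  character_kernel_set v q -> character_kernel_set v (p - q).
Proof.
have [x <-] := torus_projK p; have [y <-] := torus_projK q.
move=> /character_kernel_setP hx /character_kernel_setP hy.
rewrite -torus_projB; apply/character_kernel_setP.
by rewrite mulmxBl mxE rpredD // mxE rpredN.
Qed.

Definition character_kernel v : closed_subgroup (torus R n) :=
  ClosedSubgroup (@character_kernel_closed v) (@character_kernel0 v)
    (@character_kernelB v).

(** The filter of complements of finite sets, described by boxes. *)
Definition vectors_at_infinity : set_system 'cV[int]_n :=
  filter_from setT (fun B : nat => [set w : 'cV[int]_n | exists i, (B < `|w i 0%R|)%N]).

#[local] Instance vectors_at_infinity_filter : Filter vectors_at_infinity.
Proof.
apply: filter_from_filter; first by exists 0%N.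
move=> B C _ _; exists (maxn B C) => // w [i].
by rewrite gtn_max => /andP[Bi Ci]; split; exists i.
Qed.

(** If [w] has a large coordinate [w_j], then [x.w] becomes an integer after a
   change of [x_j] by less than [1 / |w_j|]. *)
Lemma character_kernel_at_infinity :
  character_kernel w @[w --> vectors_at_infinity] --> character_kernel 0.
Proof.
apply: chabauty_cvg_from_below => [w p|U oU].
  have [x <-] := torus_projK p => _; apply/character_kernel_setP.
  by rewrite map_mx0 mulmx0 mxE.
move=> [p [_]]; have [x <-] := torus_projK p => Ux.
have : nbhs x (@torus_proj R n @^-1` U).
  by apply: torus_proj_continuous; exact: open_nbhs_nbhs.
move=> /nbhs_ballP[e /= e0 xeU].
have [B Be] : exists B : nat, e^-1 < B%:R.
  by exists (Num.truncn e^-1).+1; exact: truncnS_gt.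
exists B => // w [j Bj].
have wj0 : 0 < `|(w j 0)%:~R : R| by rewrite -intr_norm ltr0z; lia.
pose c := (x *m map_mx intr w) 0 0.
pose d := (c - (Num.floor c)%:~R) / (w j 0)%:~R.
pose y := x - d *: delta_mx 0 j.
exists (torus_proj y); split; last first.
  apply: xeU; split=> // i k; rewrite (ord1 i) /ball /= !mxE eqxx opprD addrA subrr.
  rewrite sub0r opprK; case: eqP => _; rewrite ?mulr0 ?normr0 // mulr1.
  rewrite normrM normfV ltr_pdivrMr //.
  apply: (@lt_le_trans _ _ 1).
    rewrite ger0_norm ?subr_ge0 ?floor_le // ltrBlDr addrC.
    by have /andP[_] := floor_itv c; rewrite rmorphD.
  rewrite mulrC -ler_pdivrMr // div1r (le_trans (ltW Be)) //.
  by rewrite -intr_norm -abszE ler_nat ltnW.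
have dw : ((d *: delta_mx 0 j : 'rV_n) *m map_mx intr w) 0 0 = c - (Num.floor c)%:~R.
  by rewrite -scalemxAl -rowE 3!mxE divfK // -normr_gt0.
have yw : (y *m map_mx intr w) 0 0 = (Num.floor c)%:~R.
  by rewrite mulmxBl mxE [X in _ + X]mxE dw -/c subKr.
by apply/character_kernel_setP; rewrite yw intr_int.
Qed.

End character_kernels.

(** * Rational subtori and lifts of one-parameter subgroups *)

(** The numbers [r, r N, r N ^ 2, ...] can be prescribed modulo 1 up to [1 / N].
   By induction [r'] takes care of [s 1, s 2, ...]; each [r = (r' + m) / N] with
   [m] an integer satisfies [r N ^ i.+1 = r' N ^ i] modulo 1, and [m] is
   chosen such that [r] is within [1 / N] of [s 0]. *)
Lemma powers_approximation (R : realType) d (s : nat -> R) (N : nat) : (0 < N)%N ->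
  exists r : R, forall i, (i < d)%N ->
  exists2 e : R, `|e| <= N%:R^-1 & r * N%:R ^+ i - s i - e \is a Num.int.
Proof.
move=> N0; have NR : 0 < N%:R :> R by rewrite ltr0n.
elim: d s => [|d IH] s; first by exists 0.
have [r' hr'] := IH (s \o S).
pose m := Num.floor (s 0%N * N%:R - r').
exists ((r' + m%:~R) / N%:R) => -[_|i]; last first.
  rewrite ltnS => /hr'[e le_e ez]; exists e => //.
  rewrite exprS mulrA divfK ?lt0r_neq0 // mulrDl -!addrA addrCA addrC addrA.
  by rewrite rpredD // ?rpredM ?intr_int ?natrX ?rpredX ?natr_int //= addrA.
exists ((r' + m%:~R) / N%:R - s 0%N); last by rewrite expr0 mulr1 subrr.
have /andP[] := floor_itv (s 0%N * N%:R - r'); rewrite -/m => m1 m2.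
rewrite rmorphD /= in m2.
have -> : (r' + m%:~R) / N%:R - s 0%N = (r' + m%:~R - s 0%N * N%:R) / N%:R.
  by rewrite [RHS]mulrBl mulfK ?lt0r_neq0.
rewrite normrM normfV (gtr0_norm NR) ler_piMl ?invr_ge0 ?ler0n //.
by rewrite ler_norml; lra.
Qed.

Section one_parameter_subgroups.
Variables (R : realType) (n : nat).

Lemma integer_vectorM d (x : 'rV[R]_d) (U : 'M[int]_(d, n)) :
  integer_vector x -> integer_vector (x *m map_mx intr U).
Proof.
move=> /mxOverP xZ; apply/mxOverP => i j; rewrite mxE rpred_sum // => k _.
by rewrite rpredM // mxE intr_int.
Qed.

Lemma line_continuous (u : 'rV[R]_n) : continuous (fun r : R => torus_proj (r *: u)).
Proof.
move=> r; apply: (@continuous_comp _ _ _ (fun r : R => r *: u)).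
  exact: scalel_continuous.
exact: torus_proj_continuous.
Qed.

Lemma line_additive (u : 'rV[R]_n) :
  zmod_morphism (fun r : R => torus_proj (r *: u)).
Proof. by move=> r s; rewrite scalerBl torus_projB. Qed.

Definition line (u : 'rV[R]_n) : {additive R -> torus R n} :=
  HB.pack (fun r : R => torus_proj (r *: u))
    (GRing.isZmodMorphism.Build _ _ _ (@line_additive u)).

Definition circle_set (u : 'rV[int]_n) : set (torus R n) :=
  range (line (map_mx intr u)).

(** The direction is an integer vector, so the line is periodic and its image
   is that of a segment. *)
Lemma circle_closed u : closed (circle_set u).
Proof.
have -> : circle_set u = line (map_mx intr u) @` `[0, 1]%classic.
  apply/seteqP; split=> [_ [r _ <-]|_ [r _ <-]]; last by exists r.
  exists (r - (Num.floor r)%:~R).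
    have /andP[r1 r2] := floor_itv r; rewrite rmorphD /= in r2.
    by rewrite /= in_itv /=; lra.
  rewrite raddfB /= [X in _ - X](_ : _ = 0) ?subr0 //.
  rewrite -torus_proj0; apply/torus_projP; rewrite subr0.
  by apply/mxOverP => i j; rewrite !mxE rpredM ?intr_int.
apply: compact_closed; first exact: torus_hausdorff.
apply: continuous_compact; last exact: segment_compact.
by apply: continuous_subspaceT; exact: line_continuous.
Qed.

Lemma circle0 u : circle_set u 0.
Proof. by exists 0 => //; rewrite raddf0. Qed.

Lemma circleB u p q : circle_set u p -> circle_set u q -> circle_set u (p - q).
Proof. by move=> [r _ <-] [s _ <-]; exists (r - s) => //; rewrite raddfB. Qed.

Definition circle u : closed_subgroup (torus R n) :=
  ClosedSubgroup (@circle_closed u) (@circle0 u) (@circleB u).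

Lemma circle_Subp u : @Subp R _ (circle u).
Proof.
apply: sub_gen_smallest; exists (line (map_mx intr u)) => //.
exact: line_continuous.
Qed.

(** If [u_0, u_1, ...] are the rows of [U], the circles of direction
   [u_0 + N u_1 + N ^ 2 u_2 + ...] lie in the subtorus and become dense in it:
   the point of parameter [r] on this circle has coordinates [r N ^ i] with
   respect to the rows, which [powers_approximation] controls modulo 1. *)
Lemma rational_subtorus_Subp d (U : 'M[int]_(d, n))
    (H : closed_subgroup (torus R n)) :
  subgroup_set H = range (fun s : 'rV[R]_d => torus_proj (s *m map_mx intr U)) ->
  @Subp R _ H.
Proof.
move=> HU.
(* [N.+1] instead of [N], as the base has to be positive. *)
pose a N : 'rV[int]_d := \row_i (N.+1%:Z ^+ i).
have cvgH : circle (a N *m U) @[N --> \oo] --> H.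
  apply: chabauty_cvg_from_below => [N _ [r _ <-]|O oO].
    by rewrite HU; exists (r *: map_mx intr (a N)) => //=; rewrite map_mxM scalemxAl.
  rewrite HU => -[_ [[s _ <-] Os]].
  have : nbhs s ((fun s : 'rV[R]_d => torus_proj (s *m map_mx intr U)) @^-1` O).
    apply: (@continuous_comp _ _ _ (fun s : 'rV[R]_d => s *m map_mx intr U)
      (@torus_proj R n)).
    - exact: mulmxr_continuous.
    - exact: torus_proj_continuous.
    - exact: open_nbhs_nbhs.
  move=> /nbhs_ballP[e /= e0 seO].
  apply: filterS (near_infty_natSinv_lt (PosNum e0)) => N /= Ne.
  have [r hr] := powers_approximation d
    (fun i => oapp (s 0) 0 (insub i)) (ltn0Sn N).
  have /choice[err herr] (j : 'I_d) : exists err : R, `|err| <= N.+1%:R^-1 /\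
      r * N.+1%:R ^+ j - s 0 j - err \is a Num.int.
    by have [err le_err] := hr j (ltn_ord j); rewrite valK; exists err.
  exists (torus_proj (r *: map_mx intr (a N *m U))); split; first by exists r.
  have -> : torus_proj (r *: map_mx intr (a N *m U)) =
      torus_proj ((s + \row_j err j) *m map_mx intr U).
    apply/torus_projP; rewrite map_mxM scalemxAl -mulmxBl.
    apply: integer_vectorM; apply/mxOverP => i j; rewrite !mxE (ord1 i).
    by rewrite rmorphXn /= opprD addrA; have [_] := herr j.
  apply: seO; split=> // i j; rewrite /ball /= !mxE (ord1 i) opprD addrA subrr.
  by rewrite sub0r normrN; have [le_err _] := herr j; exact: le_lt_trans le_err Ne.
apply: (closed_cvg (@Subp R (torus R n)) _ _ _ cvgH).
  by rewrite /Subp -closureE; exact: closed_closure.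
by apply: filterE => N; exact: circle_Subp.
Qed.

Lemma integer_vector_small (x : 'rV[R]_n) :
  integer_vector x -> (forall i, `|x 0 i| < 1) -> x = 0.
Proof.
move=> /mxOverP xZ x1; apply/rowP => i; rewrite mxE.
have := x1 i; have /intrP[m ->] := xZ 0 i.
by rewrite -intr_norm ltrz1 => m1; have -> : m = 0 by lia.
Qed.

(** Near 0 the values of [f] have small lifts; [x k], the small lift of
   [f (t / 2 ^ k)], is half of the preceding one, because [2 x k.+1 - x k] is a
   small integer vector.  So [f] agrees with a line at the points [t / 2 ^ k],
   which generate a dense subgroup, hence everywhere. *)
Lemma one_parameter_is_line (f : {additive R -> torus R n}) :
  continuous f -> exists u, f =1 line u.
Proof.
move=> cf.
have [t t0 small] : exists2 t : R, 0 < t & forall r, `|r| <= t ->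
    exists x : 'rV[R]_n, (forall i, `|x 0 i| < 4^-1) /\ torus_proj x = f r.
  have : nbhs 0 (f @^-1` (torus_proj (n := n) @` ball (0 : 'rV[R]_n) 4^-1)).
    apply: cf; rewrite raddf0; apply: open_nbhs_nbhs; split.
      by apply: torus_proj_open; exact: ball_open.
    by exists 0; [exact: ballxx|exact: torus_proj0].
  move=> /nbhs_ballP[e /= e0 eb]; exists (e / 2); first by rewrite divr_gt0.
  move=> r re; have [|x [_ bx] xr] := eb r.
    by rewrite /ball /= sub0r normrN; lra.
  exists x; split=> // i; have := bx 0 i.
  by rewrite /ball /= mxE sub0r normrN.
have tk0 k : 0 < t / 2 ^+ k by rewrite divr_gt0 // exprn_gt0.
have /choice[x hx] k : exists x : 'rV[R]_n,
    (forall i, `|x 0 i| < 4^-1) /\ torus_proj x = f (t / 2 ^+ k).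
  apply: small; rewrite gtr0_norm // ler_pdivrMr ?exprn_gt0 // ler_pMr //.
  by rewrite exprn_ege1 // ler1n.
(* The bound [1 / 4] on the lifts makes [2 x k.+1 - x k] smaller than 1. *)
have x2 k : x k.+1 + x k.+1 = x k.
  apply/eqP; rewrite -subr_eq0; apply/eqP; apply: integer_vector_small => [|i].
    apply/torus_projP; rewrite torus_projD.
    have [[_ ->] [_ ->]] := (hx k.+1, hx k); rewrite -raddfD; congr (f _).
    rewrite exprS; field.
    by rewrite expf_neq0 ?pnatr_eq0.
  have [[/(_ i) h1 _] [/(_ i) h2 _]] := (hx k.+1, hx k); rewrite !mxE.
  by move: h1 h2; rewrite !ltr_norml; lra.
have xk k : x k = (2 ^+ k)^-1 *: x 0%N.
  elim: k => [|k IH]; first by rewrite expr0 invr1 scale1r.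
  apply: (@scalerI _ _ 2); first by rewrite pnatr_eq0.
  rewrite scalerA exprS invfM mulVKf ?pnatr_eq0 // -IH.
  by rewrite scaler_nat mulr2n x2.
exists (t^-1 *: x 0%N).
pose h : {additive R -> torus R n} := f \- line (t^-1 *: x 0%N).
have ch : continuous h.
  move=> r.
  apply: (@continuous_comp _ _ _ (fun r => (f r, line (t^-1 *: x 0%N) r))
    (fun p : torus R n * torus R n => p.1 - p.2)).
    exact: (cvg_pair (cf r) (@line_continuous (t^-1 *: x 0%N) r)).
  exact: torus_sub_continuous.
have htk k : h (t / 2 ^+ k) = 0.
  rewrite /h /= -(hx k).2 xk scalerA mulrAC divff ?gt_eqF // mul1r subrr //.
move=> r; apply/eqP; rewrite -subr_eq0; apply/negPn/negP => /eqP hr0.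
have : nbhs 0 (h @^-1` ~` [set h r]).
  apply: ch; apply: open_nbhs_nbhs; split; last by rewrite raddf0 => /esym.
  apply: closed_openC; apply: accessible_closed_set1.
  by apply: hausdorff_accessible; exact: torus_hausdorff.
move=> /nbhs_ballP[e /= e0 he].
have [k tke] : exists k, t / 2 ^+ k < e.
  exists (Num.truncn (t / e)).+1; rewrite ltr_pdivrMr ?exprn_gt0 //.
  rewrite mulrC -ltr_pdivrMr // (lt_trans (truncnS_gt _)) // -natrX ltr_nat.
  exact: ltn_expl.
pose j := Num.floor (r / (t / 2 ^+ k)).
have /andP[j1 j2] := floor_itv (r / (t / 2 ^+ k)).
have hr : h (r - (t / 2 ^+ k) *~ j) = h r.
  by rewrite raddfB raddfMz htk mul0rz subr0.
apply: (he (r - (t / 2 ^+ k) *~ j)) hr.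
rewrite /ball /= sub0r normrN -mulrzr ger0_norm.
  rewrite (lt_trans _ tke) // ltrBlDl mulrC.
  by move: j2; rewrite ltr_pdivrMr // rmorphD mulrDl mul1r.
by rewrite subr_ge0 mulrC -ler_pdivlMr.
Qed.

End one_parameter_subgroups.

(** * Kernels of unimodular characters and automorphisms of the torus *)

Section rational_hyperplanes.
Variables (R : realType) (n : nat).

Lemma half_not_int : (2^-1 : R) \isn't a Num.int.
Proof.
apply/negP => /intrP[m hm].
have : (m * 2)%:~R = 1%:~R :> R by rewrite rmorphM /= -hm mulVf // pnatr_eq0.
by move=> /intr_inj; lia.
Qed.

Lemma torus_Subp : @Subp R _ (@character_kernel R n 0).
Proof.
apply: (@rational_subtorus_Subp R n n 1%:M).
apply/seteqP; split=> [p _|_ [s _ <-]].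
  by have [x <-] := torus_projK p; exists x => //; rewrite map_mx1 mulmx1.
by apply/character_kernel_setP; rewrite map_mx0 mulmx0 mxE.
Qed.

(** The matrix [1 - v c] is the projection onto the hyperplane [x.v = 0] along
   [c].  When [x.v] is an integer [m], the projection of [x] is [x - m c], which
   represents the same point of the torus. *)
Lemma unimodular_kernel_Subp (v : 'cV[int]_n) (c : 'rV[int]_n) :
  c *m v = 1%:M -> @Subp R _ (character_kernel R v).
Proof.
move=> cv1.
apply: (@rational_subtorus_Subp R n n (1%:M - v *m c)).
have projE (x : 'rV[R]_n) : x *m map_mx intr (1%:M - v *m c) =
    x - (x *m map_mx intr v) *m map_mx intr c.
  by rewrite map_mxB map_mx1 map_mxM mulmxBr mulmx1 mulmxA.
apply/seteqP; split=> [p|_ [x _ <-]].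
  have [x <-] := torus_projK p => /character_kernel_setP xv; exists x => //.
  apply/torus_projP; rewrite projE addrAC subrr add0r.
  rewrite -[integer_vector _]/(_ \in @integer_vector R n) rpredN.
  by apply: integer_vectorM; apply/mxOverP => i j; rewrite !ord1.
apply/character_kernel_setP; rewrite projE mulmxBl -!mulmxA -map_mxM cv1.
by rewrite map_mx1 mulmx1 subrr mxE.
Qed.

(** The character takes the value [1 / 2] at the point [c / 2]. *)
Lemma unimodular_kernel_proper (v : 'cV[int]_n) (c : 'rV[int]_n) :
  c *m v = 1%:M -> character_kernel R v <> character_kernel R 0.
Proof.
move=> cv1 /(congr1 (@subgroup_set _)) kv.
have : character_kernel_set v (torus_proj (2^-1 *: map_mx intr c : 'rV[R]_n)).
  rewrite -[character_kernel_set v]/(subgroup_set (character_kernel R v)) kv.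
  by apply/character_kernel_setP; rewrite map_mx0 mulmx0 mxE.
move/character_kernel_setP; rewrite -scalemxAl -map_mxM cv1 map_mx1 !mxE mulr1.
exact/negP/half_not_int.
Qed.

End rational_hyperplanes.

Lemma planar_vector_unimodular n (a t : int) :
  exists c : 'rV[int]_n.+2, c *m planar_vector n a t = 1%:M.
Proof.
exists (\row_j (if j == 0 then - t else (j == 1)%:R)).
apply/matrixP => i j; rewrite !ord1 !mxE 2!big_ord_recl !mxE /= big1 => [|k _].
  by rewrite mul1r addr0; lia.
by rewrite !mxE mul0r.
Qed.

Section torus_automorphisms.
Variable R : realType.

(** Lift the restriction of [T] to each coordinate axis to a line; its direction
   is an integer vector since the point of parameter 1 is 0 in the torus. *)
Lemma torus_aut_matrix n (T : automorphism (torus R n)) :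
  exists A : 'M[int]_n, forall x : 'rV[R]_n,
    T (torus_proj x) = torus_proj (x *m map_mx intr A).
Proof.
have lift_coord (i : 'I_n) : exists u : 'rV[R]_n, forall r,
    T (torus_proj (r *: delta_mx 0 i)) = torus_proj (r *: u).
  have addT : zmod_morphism (T \o line (delta_mx 0 i : 'rV[R]_n)).
    by move=> r s; rewrite /= scalerBl torus_projB autB.
  pose f : {additive R -> torus R n} :=
    HB.pack (T \o line (delta_mx 0 i : 'rV[R]_n))
      (GRing.isZmodMorphism.Build _ _ _ addT).
  have cf : continuous f.
    move=> r; apply: (@continuous_comp _ _ _ (line (delta_mx 0 i))).
      exact: line_continuous.
    exact: homeo_continuous.
  by have [u fu] := one_parameter_is_line cf; exists u => r; exact: (fu r).
have [u Tu] := choice lift_coord.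
have uZ i : integer_vector (u i).
  rewrite -[u i]subr0; apply/torus_projP; rewrite torus_proj0 -[u i]scale1r -Tu.
  rewrite (_ : torus_proj _ = 0) ?aut0 // -torus_proj0; apply/torus_projP.
  by rewrite subr0; apply/mxOverP => k j; rewrite !mxE mul1r; case: (_ && _).
exists (\matrix_(i, j) Num.floor (u i 0 j)) => x.
have -> : x *m map_mx intr (\matrix_(i, j) Num.floor (u i 0 j)) =
    \sum_i x 0 i *: u i.
  apply/rowP => j; rewrite mxE summxE; apply: eq_bigr => i _.
  by rewrite !mxE floorK //; have /mxOverP := uZ i; apply.
rewrite {1}[x]row_sum_delta !torus_proj_sum.
rewrite (big_morph T (aut_add T) (aut0 T)).
by apply: eq_bigr => i _; rewrite Tu.
Qed.

(** All the vectors [x (A - 1)] are integer, whereas a nonzero entry [E_ij] of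
   [A - 1] gives the value [1 / 2] when [x] is [1 / (2 E_ij)] on the axis [i]. *)
Lemma torus_matrix_inj n (A : 'M[int]_n) :
  (forall x : 'rV[R]_n, torus_proj (x *m map_mx intr A) = torus_proj x) ->
  A = 1%:M.
Proof.
move=> Aid; have EZ (x : 'rV[R]_n) :
    integer_vector (x *m map_mx intr (A - 1%:M)).
  rewrite map_mxB map_mx1 mulmxBr mulmx1; exact/torus_projP.
apply/eqP; rewrite -subr_eq0; move: (A - 1%:M) EZ => E EZ.
apply/eqP/matrixP => i j; rewrite [RHS]mxE; apply: contrapT => /eqP Eij.
have /mxOverP/(_ 0 j) := EZ ((2 * (E i j)%:~R)^-1 *: delta_mx 0 i).
rewrite -scalemxAl -rowE 3!mxE invfM mulfVK ?intr_eq0 //.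
exact/negP/half_not_int.
Qed.

(** A subgroup is moved by [T] through the inverse of [T] acting on points, so
   [P] is the matrix of that inverse. *)
Lemma torus_aut_unit_matrix n (T : automorphism (torus R n.+1)) :
  exists2 P : 'M[int]_n.+1, P \is a GRing.unit & forall v,
    aut_image T (character_kernel R v) = character_kernel R (P *m v) /\
    aut_image (aut_symm T) (character_kernel R v) =
      character_kernel R (P^-1 *m v).
Proof.
have [A TA] := torus_aut_matrix T.
have [P TP] := torus_aut_matrix (aut_symm T).
have PA : P *m A = 1%:M.
  apply: torus_matrix_inj => x.
  by rewrite map_mxM mulmxA -TA -TP /= homeo_invK.
have AP : A *m P = 1%:M by exact: mulmx1C.
have uP : P \is a GRing.unit by apply/unitrP; exists A.
exists P => //.
have PV : P^-1 = A by rewrite -[LHS]mul1mx -AP; exact: mulrK.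
have kernel_image (S : automorphism (torus R n.+1)) (B : 'M[int]_n.+1) v :
    (forall x : 'rV[R]_n.+1, aut_symm S (torus_proj x) =
       torus_proj (x *m map_mx intr B)) ->
    aut_image S (character_kernel R v) = character_kernel R (B *m v).
  move=> SB; apply: closed_subgroup_inj; rewrite /= homeo_image.
  apply/seteqP; split=> p; have [x <-] := torus_projK p.
    rewrite /preimage /= [homeo_inv _ _]SB => /character_kernel_setP xv.
    by apply/character_kernel_setP; rewrite map_mxM mulmxA.
  move=> /character_kernel_setP; rewrite map_mxM mulmxA => xv.
  rewrite /preimage /= [homeo_inv _ _]SB.
  exact/character_kernel_setP.
by move=> v; rewrite PV; split; apply: kernel_image.
Qed.

Lemma homeo_iter_kernel n (T : automorphism (torus R n.+1)) (P : 'M[int]_n.+1)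
    (x : @Subp R (torus R n.+1)) v (k : int) :
  (forall v,
    aut_image T (character_kernel R v) = character_kernel R (P *m v) /\
    aut_image (aut_symm T) (character_kernel R v) =
      character_kernel R (P^-1 *m v)) ->
  val x = character_kernel R v ->
  val (homeo_iter (Subp_homeo R T) k x) = character_kernel R (P ^ k *m v).
Proof.
move=> hP xv; case: k => m; rewrite /homeo_iter.
  elim: m => [|m IH] /=; first by rewrite expr0z mul1mx.
  by rewrite IH (hP _).1 mulmxA -!exprnP exprS.
rewrite NegzE -exprnN -exprVn.
elim: m.+1 => {m} [|m IH] /=; first by rewrite expr0 mul1mx.
by rewrite IH (hP _).2 mulmxA exprS.
Qed.

End torus_automorphisms.

Theorem theorem4p2 (R : realType) (n : nat) (hn : (2 <= n)%N) :
  ~ exists T : automorphism (torus R n), acts_expansively_on_Subp R T.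
Proof.
case: n hn => [|[|n]] // _ [T [d dm [e e0 hexp]]].
have [P uP hP] := torus_aut_unit_matrix T.
pose top : @Subp R (torus R n.+2) := SigSub (mem_set (@torus_Subp R n.+2)).
have : nbhs top [set z | d top z < e].
  by rewrite (cmetric_nbhs dm); exists e.
rewrite nbhsE => -[_ [[W oW <-] Wtop] We].
have : nbhs (character_kernel R (0 : 'cV_n.+2)) W by exact: open_nbhs_nbhs.
move=> /(@character_kernel_at_infinity R n.+2)[B _ BW].
have [a [t esc]] := escaping_planar_vector B uP.
have [c cv1] := planar_vector_unimodular n a t.
pose x : @Subp R (torus R n.+2) := SigSub (mem_set (@unimodular_kernel_Subp R _ _ _ cv1)).
have : x <> top.
  by move=> /(congr1 val); exact: (unimodular_kernel_proper cv1).
move=> /hexp /ereal_sup_gt[_ [k _ <-]]; rewrite lte_fin; apply/negP.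
rewrite -leNgt ltW // (cmetric_sym dm).
have -> : homeo_iter (Subp_homeo R T) k top = top.
  by apply: val_inj; rewrite (homeo_iter_kernel k hP (erefl (val top))) mulmx0.
apply: We; suff : W (val (homeo_iter (Subp_homeo R T) k x)) by [].
by rewrite (homeo_iter_kernel k hP (erefl (val x))); exact: BW.
Qed.
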